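(* Let $\Omega$ be a set and $\mathcal{K}\subset\mathbb{R}^{\Omega}$ a convex cone. Let $\mathcal{K}_b=\{k\in\mathcal{K}:k^-\text{ is bounded}\}$ and $$\mathscr{M}(\mathcal{K}_b)=\Big\{m\in\mathbb{P}_{ba}:\ \mathcal{K}_b\subset L(m),\ \sup_{k\in\mathcal{K}_b}m(k)\leq0\Big\}.$$ Then $\mathscr{M}(\mathcal{K}_b)$ is non empty if and only if $\mathcal{K}$ contains no sure wins.
   Context: A convex cone is a (nonempty) set $\mathcal{K}\subset\mathbb{R}^\Omega$ such that $f+g,\lambda f\in\mathcal{K}$ whenever $f,g\in\mathcal{K}$ and $\lambda\geq0$. Functions are ordered pointwise; $k^-$ is the negative part of $k$. A sure win is a function $f\in\mathbb{R}^\Omega$ with $f\geq1$ pointwise on $\Omega$. $\mathbb{P}_{ba}$ is the set of all finitely additive probabilities on $2^\Omega$, i.e. nonnegative finitely additive set functions $m$ on $2^\Omega$ with $m(\Omega)=1$. For such $m$, $L(m)$ is the space of $m$-integrable functions in the finitely additive sense, and $m(f)$ denotes the integral: a function $f\geq0$ is in $L(m)$ iff $\sup\{m(h):h\text{ bounded},0\leq h\leq f\}<\infty$, in which case $m(f)$ is this supremum; a general $f$ is in $L(m)$ iff $f^+,f^-\in L(m)$, and $m(f)=m(f^+)-m(f^-)$. *)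

(* Defs.v *)
From mathcomp Require Import all_boot all_order all_algebra.
From mathcomp Require Import all_classical all_reals all_analysis.

Set Implicit Arguments.
Unset Strict Implicit.
Unset Printing Implicit Defensive.

Import Order.TTheory GRing.Theory Num.Theory.
Import numFieldNormedType.Exports.

Local Open Scope classical_set_scope.
Local Open Scope ring_scope.

Section ba_integration.
Context {R : realType} {Omega : Type}.
Implicit Types (K : set (Omega -> R)) (f g h k : Omega -> R).
Implicit Types (m : set Omega -> R) (s : {fimfun Omega >-> R}).

Definition convex_cone K : Prop :=
  [/\ K !=set0,
      forall f g, K f -> K g -> K (f \+ g) &
      forall (lambda : R) f, 0 <= lambda -> K f -> K (fun x => lambda * f x)].

Definition sure_win f : Prop := forall x, 1 <= f x.

Definition bounded_neg_part K : set (Omega -> R) :=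
  [set k | K k /\ bounded_fun (k^\-)].

(* Set functions on the full powerset are represented directly: the library's
   [content]s live on [semiRingOfSetsType]s, which are pointed, whereas here
   [Omega] may be empty. *)
Definition ba_probability m : Prop :=
  [/\ forall A, 0 <= m A,
      forall A B, A `&` B = set0 -> m (A `|` B) = m A + m B &
      m [set: Omega] = 1].

Definition simple_integral m s : R :=
  \sum_(r \in range s) r * m (s @^-1` [set r]).

(* The integral of a bounded [h]: every subset of [Omega] is measurable, so [h]
   is a uniform limit of finite-valued functions and its integral is the
   supremum of the integrals of those below it. Junk if [h] is unbounded. *)
Definition bounded_integral m h : R :=
  sup [set simple_integral m s
      | s in [set s : {fimfun Omega >-> R} | forall x, s x <= h x]].

Definition bounded_minorants f : set (Omega -> R) :=
  [set h : Omega -> R | bounded_fun h /\ forall x, 0 <= h x <= f x].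

(* For [f >= 0]: this set of reals has an upper bound iff [f] is in [L(m)]. *)
Definition minorant_integrals m f : set R :=
  [set bounded_integral m h | h in bounded_minorants f].

Definition ba_L m : set (Omega -> R) :=
  [set f | has_ubound (minorant_integrals m f^\+) /\
           has_ubound (minorant_integrals m f^\-)].

(* Meaningful only for [f] in [ba_L m]. *)
Definition ba_integral m f : R :=
  sup (minorant_integrals m f^\+) - sup (minorant_integrals m f^\-).

Definition ba_M K : set (set Omega -> R) :=
  [set m | [/\ ba_probability m,
               K `<=` ba_L m &
               (ereal_sup [set (ba_integral m k)%:E | k in K] <= 0)%E]].

End ba_integration.

(* Main.v *)
Require Import Defs.
From mathcomp Require Import all_boot all_order all_algebra.
From mathcomp Require Import all_classical all_reals all_analysis.
From mathcomp Require Import lra.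

Set Implicit Arguments.
Unset Strict Implicit.
Unset Printing Implicit Defensive.

Import Order.TTheory GRing.Theory Num.Theory.

Local Open Scope classical_set_scope.
Local Open Scope ring_scope.

(** If [K] has no sure win, Zorn's lemma embeds it in a maximal downward closed
    convex cone [C] without sure wins, and maximality forces [C f] or [C (- f)]
    for every [f].  Hence a bounded [f] has a price, the cut point [c] between
    the [a] with [C (f - a)] and those with [C (a - f)], and the price is linear
    and monotone.  Pricing indicators gives [m].  For [k] in [K] with [k^\-]
    bounded and a simple [s <= k^\+], one has [s - k^\- <= k], so the price of
    [s] is at most that of [k^\-]; hence [m k <= 0]. *)

(** * Maximal convex cones without sure wins *)

Section Cones.
Context {R : realType} {Omega : Type}.
Implicit Types (K C : set (Omega -> R)) (f g h k : Omega -> R).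

Definition lower_cone C : Prop :=
  [/\ convex_cone C,
      forall f g, C g -> (forall x, f x <= g x) -> C f &
      forall f, C f -> ~ sure_win f].

Lemma lower_cone0 C : lower_cone C -> C (cst 0).
Proof.
move=> [[[f Cf] _ CZ] Cle _]; apply: (Cle _ _ (CZ 0 f (lexx 0) Cf)) => x /=.
by rewrite mul0r.
Qed.

(** Scaling by [e^-1] turns a function bounded below by [e] into a sure win. *)
Lemma lower_cone_pos C f (e : R) :
  lower_cone C -> C f -> 0 < e -> ~ (forall x, e <= f x).
Proof.
move=> [[_ _ CZ] _ Csw] Cf e0 ef.
have ei : 0 <= e^-1 by rewrite invr_ge0 ltW.
by apply: (Csw _ (CZ _ _ ei Cf)) => x; rewrite mulrC ler_pdivlMr// mul1r.
Qed.

(** For a convex cone [C], the downward closure of the cone generated by [C] and [f]; taking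
    [f = cst 0] gives the downward closure of [C] itself. *)
Definition adjoin C f : set (Omega -> R) :=
  [set h | exists g t, [/\ C g, 0 <= t & forall x, h x <= g x + t * f x]].

Lemma adjoin_lower_cone C f : convex_cone C ->
  (forall h, adjoin C f h -> ~ sure_win h) -> lower_cone (adjoin C f).
Proof.
move=> [[g0 Cg0] CD CZ] sw; split => //.
- split.
  + exists g0, g0, 0; split=> // x; lra.
  + move=> h1 h2 [g1 [t1 [Cg1 t10 h1g]]] [g2 [t2 [Cg2 t20 h2g]]].
    exists (g1 \+ g2), (t1 + t2); split; [exact: CD|exact: addr_ge0|move=> x /=].
    move: (h1g x) (h2g x); lra.
  + move=> l h l0 [g [t [Cg t0 hg]]].
    exists (fun x => l * g x), (l * t); split; [exact: CZ|exact: mulr_ge0|].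
    by move=> x; rewrite -mulrA -mulrDr; apply: ler_wpM2l.
- move=> h1 h2 [g [t [Cg t0 h2g]]] h12; exists g, t; split=> // x.
  exact: le_trans (h12 x) (h2g x).
Qed.

(** If a maximal [C] misses [f], adjoining [f] must create a sure win below some [g + t f] with [g]
    in [C]; then [t > 0] and [- f <= g / t], so [C] contains [- f]. *)
Lemma total_lower_cone K : convex_cone K ->
  ~ (exists f, K f /\ sure_win f) ->
  exists C, [/\ lower_cone C, K `<=` C & forall f, C f \/ C (\- f)].
Proof.
move=> HK nsw.
(* [set0] is admitted because [Zorn_bigcup] also covers the empty chain. *)
pose P : set (set (Omega -> R)) :=
  [set X | X = set0 \/ (lower_cone X /\ K `<=` X)].
(* This nonempty member of [P] later shows that the maximal element is not [set0]. *)
have PK : P (adjoin K (cst 0)).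
  right; split.
    apply: adjoin_lower_cone => // h [g [t [Kg t0 hg]]] hsw; apply: nsw.
    exists g; split=> // x; move: (hg x) (hsw x) => /=; rewrite mulr0; lra.
  move=> g Kg; exists g, 0; split=> // x; lra.
have chainP (F : set (set (Omega -> R))) :
    F `<=` P -> total_on F subset -> P (\bigcup_(X in F) X).
  move=> FP Ftot.
  (* Any nonempty member of the chain is a lower cone containing [K]; without one, the union is
     [set0]. *)
  have [[X0 [FX0 X0ne]]|none] := pselect (exists X, F X /\ X !=set0); last first.
    left; apply/seteqP; split=> // x [X FX Xx]; apply: none.
    by exists X; split=> //; exists x.
  have lc X f : F X -> X f -> lower_cone X /\ K `<=` X.
    by move=> FX Xf; have [X0'|//] := FP _ FX; rewrite X0' in Xf.
  right; split; last first.
    case: X0ne => f X0f; have [_ KX0] := lc _ _ FX0 X0f.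
    by move=> k /KX0; exists X0.
  split.
  - split.
    + by case: X0ne => f X0f; exists f, X0.
    + move=> f g [X FX Xf] [Y FY Yg].
      have [[[_ XD _] _ _] _] := lc _ _ FX Xf.
      have [[[_ YD _] _ _] _] := lc _ _ FY Yg.
      have [XY|YX] := Ftot _ _ FX FY.
        by exists Y => //; apply: YD => //; exact: XY.
      by exists X => //; apply: XD => //; exact: YX.
    + move=> l f l0 [X FX Xf]; have [[[_ _ XZ] _ _] _] := lc _ _ FX Xf.
      by exists X => //; exact: XZ.
  - move=> f g [X FX Xg] fg; have [[_ Xle _] _] := lc _ _ FX Xg.
    by exists X => //; exact: Xle fg.
  - by move=> f [X FX Xf]; have [[_ _ Xsw] _] := lc _ _ FX Xf; exact: Xsw.
have [C [PC Cmax]] := Zorn_bigcup chainP.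
have [[LC KC]|] : (lower_cone C /\ K `<=` C) \/ C = set0 by case: PC; [right|left].
- exists C; split=> // f.
  have [Cf|nCf] := pselect (C f); [by left|right].
  have [CC Cle Csw] := LC.
  have C_adj : C `<=` adjoin C f.
    by move=> g Cg; exists g, 0; split=> // x; lra.
  have adjf : adjoin C f f.
    exists (cst 0), 1; split=> [|//|x /=]; [exact: lower_cone0|lra].
  have [h [[g [t [Cg t0 hg]]] hsw]] : exists h, adjoin C f h /\ sure_win h.
    apply: contrapT => noh; apply: (Cmax (adjoin C f)).
      by split=> // /(_ _ adjf).
    right; split; last exact: subset_trans C_adj.
    apply: adjoin_lower_cone => // h ah hsw; apply: noh; by exists h.
  (* With [t = 0], the function [g] of [C] would itself be a sure win. *)
  have t_gt0 : 0 < t.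
    rewrite lt_neqAle t0 andbT; apply/eqP => t_eq0; apply: (Csw _ Cg) => x.
    by move: (hg x) (hsw x); rewrite -t_eq0; lra.
  have [_ _ CZ] := CC.
  have ti : 0 <= t^-1 by rewrite invr_ge0.
  apply: (Cle _ _ (CZ _ _ ti Cg)) => x /=.
  rewrite mulrC ler_pdivlMr// mulNr mulrC; move: (hg x) (hsw x); lra.
- move=> C0; exfalso; apply: (Cmax (adjoin K (cst 0))) => //.
  rewrite C0; split=> // /(_ (cst 0)) []; have [[k Kk] _ KZ] := HK.
  exists (fun x => 0 * k x), 0; split=> [|//|x /=]; [exact: KZ|lra].
Qed.

End Cones.

(** * Prices with respect to a total lower cone *)

Section Price.
Context {R : realType} {Omega : Type} (C : set (Omega -> R)).
Hypothesis LC : lower_cone C.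
Hypothesis Ctot : forall f, C f \/ C (\- f).
Implicit Types (f g h : Omega -> R) (a b c e : R).

Let CD f g : C f -> C g -> C (f \+ g).
Proof. by have [[_ + _] _ _] := LC; apply. Qed.

Let CZ a f : 0 <= a -> C f -> C (fun x => a * f x).
Proof. by have [[_ _ +] _ _] := LC; apply. Qed.

Let Cle f g : C g -> (forall x, f x <= g x) -> C f.
Proof. by have [_ + _] := LC; apply. Qed.

(** The margin [e] is there because [C] need not be closed: at the cut point itself, [f - c] or
    [c - f] may fall outside [C]. *)
Definition price f c : Prop :=
  forall e, 0 < e -> C (fun x => f x - c - e) /\ C (fun x => c - f x - e).

(** If [c > 0], adding [f] to [c - f - c / 2] puts the positive constant [c / 2] in [C]. *)
Lemma price_cone f c : C f -> price f c -> c <= 0.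
Proof.
move=> Cf fc; rewrite leNgt; apply/negP => c0.
have c2 : 0 < c / 2 by lra.
have [_ C2] := fc _ c2.
apply: (lower_cone_pos LC (CD Cf C2) c2) => x /=; lra.
Qed.

Lemma priceD f g a b : price f a -> price g b -> price (f \+ g) (a + b).
Proof.
move=> fa gb e e0; have e2 : 0 < e / 2 by lra.
have [fa1 fa2] := fa _ e2; have [gb1 gb2] := gb _ e2.
by split; [apply: (Cle (CD fa1 gb1))|apply: (Cle (CD fa2 gb2))] => x /=; lra.
Qed.

Lemma price_cst c : price (cst c) c.
Proof.
by move=> e e0; split; apply: (Cle (lower_cone0 LC)) => x /=; lra.
Qed.

Lemma priceZ r f c : price f c -> price (fun x => r * f x) (r * c).
Proof.
have pos (s : R) (g : Omega -> R) a :
    0 < s -> price g a -> price (fun x => s * g x) (s * a).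
  move=> s0 ga e e0; have es : 0 < e / s by exact: divr_gt0.
  have [ga1 ga2] := ga _ es.
  have ess : s * (e / s) = e by rewrite mulrC divfK// gt_eqF.
  by split; [apply: (Cle (CZ (ltW s0) ga1))|apply: (Cle (CZ (ltW s0) ga2))] => x /=;
    rewrite !mulrBr ess.
move=> fc; have [r0|r0|->] := ltgtP r 0; last 2 first.
- exact: pos.
- have -> : (fun x => 0 * f x) = cst 0 by apply/funext => x /=; rewrite mul0r.
  by rewrite mul0r; exact: price_cst.
(* A negative factor exchanges the two conditions in [price], so the case of [- r] applies with its
   halves swapped. *)
have nr : 0 < - r by lra.
move=> e e0; have [fc1 fc2] := pos _ _ _ nr fc _ e0.
by split; [apply: (Cle fc2)|apply: (Cle fc1)] => x /=; lra.
Qed.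

(** The difference [f - g <= 0] lies in [C] and has price [a - b]. Applied in both directions, this
    also gives uniqueness of prices. *)
Lemma price_le f g a b :
  price f a -> price g b -> (forall x, f x <= g x) -> a <= b.
Proof.
move=> fa gb fg; have := priceD fa (priceZ (-1) gb).
move/price_cone => H; suff : a + -1 * b <= 0 by lra.
apply: H; apply: (Cle (lower_cone0 LC)) => x /=; move: (fg x); lra.
Qed.

Lemma price_sum (I : Type) (r : seq I) (F : I -> Omega -> R) (c : I -> R) :
  (forall i, price (F i) (c i)) ->
  price (fun x => \sum_(i <- r) F i x) (\sum_(i <- r) c i).
Proof.
move=> Fc; elim: r => [|i r IH].
  rewrite big_nil; under eq_fun do rewrite big_nil; exact: price_cst.
rewrite big_cons; under eq_fun do rewrite big_cons; exact: priceD.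
Qed.

Lemma price_exists f a b : (forall x, a <= f x <= b) -> exists c, price f c.
Proof.
(* The price is [inf S]: [b] is in [S] because [f - b <= 0], and [a] bounds [S] below because
   [c < a] would make [f - c] uniformly positive. *)
move=> fab; pose S : set R := [set c | C (fun x => f x - c)].
have Sb : S b.
  by apply: (Cle (lower_cone0 LC)) => x /=; move: (fab x) => /andP[]; lra.
have lbS : lbound S a.
  move=> c Sc; rewrite leNgt; apply/negP => ca.
  have ac0 : 0 < a - c by lra.
  by apply: (lower_cone_pos LC Sc ac0) => x; move: (fab x) => /andP[]; lra.
have Sinf : has_inf S by split; [exists b|exists a].
exists (inf S) => e e0; split.
  have [c Sc cinf] := inf_adherent e0 Sinf.
  by apply: (Cle Sc) => x; lra.
(* Totality decides: [inf S - e] cannot belong to [S], so the opposite function is in [C]. *)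
have [Sc|Cn] := Ctot (fun x => f x - (inf S - e)).
  have := ge_inf (proj2 Sinf) Sc; lra.
by apply: (Cle Cn) => x /=; lra.
Qed.

Lemma indic_itv (A : set Omega) x : 0 <= (\1_A x : R) <= 1.
Proof. by rewrite indicE; case: (x \in A); rewrite /= ?lexx ler01. Qed.

Definition price_measure (A : set Omega) : R :=
  sval (cid (price_exists (indic_itv A))).

Lemma price_indic (A : set Omega) : price \1_A (price_measure A).
Proof. exact: svalP. Qed.

Lemma price_measure_ba : ba_probability price_measure.
Proof.
split.
- move=> A; apply: (price_le (price_cst 0) (price_indic A)) => x.
  by have /andP[] := indic_itv A x.
- move=> A B AB0.
  have AB : \1_(A `|` B) = \1_A \+ \1_B :> (Omega -> R).
    apply/funext => x /=; rewrite !indicE in_setU.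
    have [xA|_] := boolP (x \in A); have [xB|_] := boolP (x \in B) => /=.
    + have : (A `&` B) x by split; exact: set_mem.
      by rewrite AB0.
    + by rewrite addr0.
    + by rewrite add0r.
    + by rewrite addr0.
  (* Both sides of the additivity equation are prices of the same function, hence equal. *)
  have pAB := priceD (price_indic A) (price_indic B).
  have := price_indic (A `|` B); rewrite AB => pU.
  by apply/eqP; rewrite eq_le (price_le pU pAB)// (price_le pAB pU).
- have := price_indic [set: Omega]; rewrite indicT => p1.
  by apply/eqP; rewrite eq_le (price_le p1 (price_cst 1))// (price_le (price_cst 1) p1).
Qed.

(** A simple function is a finite combination of indicators of its level sets, so linearity of the
    price yields its integral. *)
Lemma price_simple (s : {fimfun Omega >-> R}) :
  price s (simple_integral price_measure s).
Proof.
have -> : s = (fun x => \sum_(y \in range s) y * \1_(s @^-1` [set y]) x) :> (Omega -> R).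
  by apply/funext => x; exact: fimfunE.
rewrite /simple_integral fsbig_finite//=.
under eq_fun do rewrite fsbig_finite//=.
by apply: price_sum => r; apply: priceZ; exact: price_indic.
Qed.

End Price.

(** * Finitely additive integrals and their comparison with prices *)

Section Integral.
Context {R : realType} {Omega : Type}.
Implicit Types (f h k : Omega -> R) (m : set Omega -> R).
Implicit Types (s : {fimfun Omega >-> R}).

Lemma bounded_integral_le m h c : (forall x, 0 <= h x) ->
  (forall s, (forall x, s x <= h x) -> simple_integral m s <= c) ->
  bounded_integral m h <= c.
Proof.
move=> h0 hc; apply: ge_sup.
  by exists (simple_integral m (cst_fimfun 0)), (cst_fimfun 0).
by move=> _ [s sh <-]; exact: hc.
Qed.

(** The bound [c] only ensures that the supremum defining [bounded_integral] is a genuine one. *)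
Lemma simple_integral_bounded m s h c :
  (forall s, (forall x, s x <= h x) -> simple_integral m s <= c) ->
  (forall x, s x <= h x) -> simple_integral m s <= bounded_integral m h.
Proof.
move=> hc sh; apply: ub_le_sup; last by exists s.
by exists c => _ [s' s'h <-]; exact: hc.
Qed.

(** Simple functions below a bounded minorant of [f] are below [f], so the two nested suprema need
    only a bound on simple functions. *)
Lemma minorant_integrals_le m f c : (forall x, 0 <= f x) ->
  (forall s, (forall x, s x <= f x) -> simple_integral m s <= c) ->
  ubound (minorant_integrals m f) c.
Proof.
move=> f0 fc _ [h [_ hf] <-]; apply: bounded_integral_le => [x|s sh].
  by have /andP[] := hf x.
by apply: fc => x; have /andP[_] := hf x; exact: le_trans.
Qed.

Lemma bounded_fun_cst (c : R) : bounded_fun (cst c : Omega -> R).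
Proof.
by exists `|c|; split=> [|M cM x _ /=]; [exact: num_real|exact: ltW].
Qed.

Lemma sup_minorants_le m f c : (forall x, 0 <= f x) ->
  (forall s, (forall x, s x <= f x) -> simple_integral m s <= c) ->
  sup (minorant_integrals m f) <= c.
Proof.
move=> f0 fc; apply: ge_sup; last exact: minorant_integrals_le.
exists (bounded_integral m (cst 0)), (cst 0) => //; split.
  exact: bounded_fun_cst.
by move=> x; rewrite /= lexx f0.
Qed.

Lemma ba_preimage_sum m s (l : seq R) : ba_probability m -> uniq l ->
  \sum_(r <- l) m (s @^-1` [set r]) = m (s @^-1` [set` l]).
Proof.
move=> [_ mD _]; have m0 : m set0 = 0.
  by have := mD set0 set0; rewrite setI0 setU0 => /(_ erefl); lra.
elim: l => [|r l IH] /=.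
  by rewrite big_nil -m0 => _; congr m; apply/seteqP; split.
move=> /andP[rl ul]; rewrite big_cons IH// -mD; last first.
  apply/seteqP; split=> // x [/= -> ]; by rewrite (negbTE rl).
congr m; apply/seteqP; split=> x /=; rewrite in_cons.
  by case=> [->|->]; rewrite ?eqxx ?orbT.
by case/orP => [/eqP ->|]; [left|right].
Qed.

(** The level sets of [s] partition [Omega], of mass 1, so the constant can be distributed over
    them; the sign of each term then compares the integral with [c]. *)
Lemma simple_integral_split m s c : ba_probability m ->
  simple_integral m s - c = \sum_(r <- finmap.enum_fset (fset_set (range s)))
    (r - c) * m (s @^-1` [set r]).
Proof.
move=> bam; under eq_bigr do rewrite mulrBl.
rewrite sumrB -mulr_sumr ba_preimage_sum// ?finmap.fset_uniq//.
have -> : s @^-1` [set` finmap.enum_fset (fset_set (range s))] = [set: Omega].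
  apply/seteqP; split=> // x _ /=.
  by rewrite in_fset_set//; apply: mem_set; exists x.
have [_ _ ->] := bam.
by rewrite mulr1 /simple_integral fsbig_finite.
Qed.

Lemma fset_range s r :
  r \in finmap.enum_fset (fset_set (range s)) -> exists x, s x = r.
Proof. by rewrite in_fset_set// => /set_mem[x _ <-]; exists x. Qed.

Lemma simple_integral_le m s c : ba_probability m ->
  (forall x, s x <= c) -> simple_integral m s <= c.
Proof.
move=> bam sc; rewrite -subr_le0 simple_integral_split// big_seq sumr_le0//.
move=> _ /fset_range[x <-]; have [m0 _ _] := bam.
by rewrite mulr_le0_ge0// subr_le0.
Qed.

Lemma simple_integral_ge m s c : ba_probability m ->
  (forall x, c <= s x) -> c <= simple_integral m s.
Proof.
move=> bam sc; rewrite -subr_ge0 simple_integral_split// big_seq sumr_ge0//.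
move=> _ /fset_range[x <-]; have [m0 _ _] := bam.
by rewrite mulr_ge0// subr_ge0.
Qed.

(** Rounding [h] down to a multiple of [e] leaves finitely many values, since [h] is at most [M]. *)
Lemma simple_approx h (M e : R) : (forall x, 0 <= h x <= M) -> 0 < e ->
  exists s, forall x, s x <= h x <= s x + e.
Proof.
move=> hM e0; pose t x := e * (Num.truncn (h x / e))%:R.
have ft : t \in fimfun.
  apply/mem_set; apply: (@sub_finite_set _ _
    ((fun n : nat => e * n%:R) @` `I_(Num.truncn (M / e)).+1)).
    move=> _ [x _ <-]; exists (Num.truncn (h x / e)) => //=.
    rewrite ltnS; apply: le_truncn; rewrite ler_pM2r ?invr_gt0//.
    by have /andP[] := hM x.
  exact/finite_image/finite_II.
exists (fimfun_Sub ft) => x; have /andP[h0 _] := hM x.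
have /andP[l u] := truncn_itv (divr_ge0 h0 (ltW e0)).
rewrite -[fimfun_Sub ft x]/(t x) /t.
rewrite ler_pdivlMr// mulrC in l; rewrite l /=.
by rewrite ltr_pdivrMr// -natr1 mulrDl mul1r mulrC in u; exact: ltW.
Qed.

Lemma sure_win_integral m f : ba_probability m -> ba_L m f -> sure_win f ->
  1 <= ba_integral m f.
Proof.
move=> bam [fL _] fsw; rewrite /ba_integral.
have neg : sup (minorant_integrals m f^\-) <= 0.
  apply: sup_minorants_le => [x|s sf]; first exact: funrneg_ge0.
  apply: simple_integral_le => // x; apply: le_trans (sf x) _.
  by rewrite ge_max lexx andbT oppr_le0 (le_trans ler01 (fsw x)).
suff : 1 <= sup (minorant_integrals m f^\+) by lra.
(* The constant 1 is a bounded minorant of [f^\+], and as a simple function it bounds its own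
   integral below by 1. *)
apply: (@le_trans _ _ (bounded_integral m (cst 1))); last first.
  apply: ub_le_sup => //; exists (cst 1) => //; split.
    exact: bounded_fun_cst.
  by move=> x; rewrite /= ler01 le_max fsw.
apply: (@le_trans _ _ (simple_integral m (cst_fimfun 1))).
  exact: simple_integral_ge.
apply: (@simple_integral_bounded _ _ _ 1) => // s s1.
exact: simple_integral_le.
Qed.

Lemma bounded_funE h : bounded_fun h -> exists M, forall x, `|h x| <= M.
Proof.
by move=> [M [_ hM]]; exists (M + 1) => x; apply: hM => //; rewrite ltrDl.
Qed.

(** The price [v] of the bounded function [k^\-] separates the two integrals. Since [k^\+] may be
    unbounded and have no price, only simple functions below it are priced. *)
Lemma price_integral (C : set (Omega -> R)) (LC : lower_cone C)
    (Ctot : forall f, C f \/ C (\- f)) k :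
  C k -> bounded_fun k^\- ->
  ba_L (price_measure LC Ctot) k /\
  ba_integral (price_measure LC Ctot) k <= 0.
Proof.
move=> Ck /[dup] kb /bounded_funE[M kM]; set m := price_measure LC Ctot.
have kM' x : 0 <= k^\- x <= M.
  by rewrite funrneg_ge0 (le_trans (ler_norm _) (kM x)).
have [v kv] := price_exists LC Ctot kM'.
have neg s : (forall x, s x <= k^\- x) -> simple_integral m s <= v.
  exact: (price_le LC (price_simple LC Ctot s) kv).
have pos s : (forall x, s x <= k^\+ x) -> simple_integral m s <= v.
  move=> sk; suff : simple_integral m s + -1 * v <= 0 by lra.
  apply: (price_cone LC _
    (priceD LC (price_simple LC Ctot s) (priceZ LC (-1) kv))).
  have [_ Cle _] := LC; apply: (Cle _ _ Ck) => x /=.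
  have := sk x; have : k^\+ x - k^\- x = k x.
    by rewrite /funrpos /funrneg; case: (lerP (k x) 0) => ?; case: lerP; lra.
  lra.
have posub := minorant_integrals_le (funrpos_ge0 k) pos.
have negub := minorant_integrals_le (funrneg_ge0 k) neg.
split; first by split; exists v.
have := sup_minorants_le (funrpos_ge0 k) pos.
(* Being bounded, [k^\-] is its own minorant, and simple functions within [e] of it from below have
   integral at least [v - e]. *)
suff : v <= sup (minorant_integrals m k^\-) by rewrite /ba_integral; lra.
apply: (@le_trans _ _ (bounded_integral m k^\-)); last first.
  apply: ub_le_sup; first by exists v.
  by exists k^\- => //; split=> // x; rewrite lexx andbT funrneg_ge0.
apply/ler_addgt0Pr => e e0; have [s sk] := simple_approx kM' e0.
apply: (@le_trans _ _ (simple_integral m s + e)).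
  apply: (price_le LC kv (priceD LC (price_simple LC Ctot s) (price_cst LC e))).
  by move=> x; have /andP[] := sk x.
rewrite lerD2r; apply: (simple_integral_bounded neg) => x.
by have /andP[] := sk x.
Qed.

End Integral.

Theorem proposition1 (R : realType) (Omega : Type) (K : set (Omega -> R))
    (HK : convex_cone K) :
  ba_M (bounded_neg_part K) !=set0 <-> ~ (exists f, K f /\ sure_win f).
Proof.
split.
- move=> [m [bam mL msup]] [f [Kf fsw]].
  (* A sure win has zero negative part, so it belongs to [bounded_neg_part K]; its integral is then
     both at least 1 and at most 0. *)
  have f0 : f^\- = cst 0.
    apply/funext => x /=; apply/max_idPr.
    by rewrite oppr_le0 (le_trans ler01 (fsw x)).
  have Kbf : bounded_neg_part K f.
    by split=> //; rewrite f0; exact: bounded_fun_cst.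
  have mf := sure_win_integral bam (mL _ Kbf) fsw.
  have : ((ba_integral m f)%:E <= 0)%E.
    by apply: le_trans msup; apply: ereal_sup_ubound; exists f.
  rewrite lee_fin; lra.
- move=> nsw; have [C [LC KC Ctot]] := total_lower_cone HK nsw.
  exists (price_measure LC Ctot); split.
  + exact: price_measure_ba.
  + by move=> k [/KC Ck kb]; have [] := price_integral LC Ctot Ck kb.
  + apply: ge_ereal_sup => _ [k [/KC Ck kb] <-].
    by rewrite lee_fin; have [] := price_integral LC Ctot Ck kb.
Qed.
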